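(* If $G\in\mathcal{F}_2$, then $G$ is a singleton-partition graph and ${\rm CG}(G,\Gamma_1)\in\mathcal{H}_2$.
   Context: All graphs are finite and simple. A full vertex is a vertex adjacent to all other vertices. A set $D\subseteq V$ is dominating if every vertex not in $D$ has a neighbor in $D$. Two disjoint sets $A,B\subseteq V$ form a coalition if neither is dominating but $A\cup B$ is. A coalition partition of $G$ is a partition $\mathcal{P}$ of $V$ such that every member is either a dominating set of cardinality 1, or is not dominating and forms a coalition with some other member of $\mathcal{P}$. The coalition graph ${\rm CG}(G,\mathcal{P})$ has vertex set $\mathcal{P}$, two members adjacent iff they form a coalition. $\Gamma_1$ is the partition of $V$ into singletons; $G$ is a singleton-partition graph if $\Gamma_1$ is a coalition partition of $G$. The family $\mathcal{F}_2=\mathcal{F}_2^1\cup\mathcal{F}_2^2\cup\mathcal{F}_2^3$. In each case $G$ has vertex set $V=\{x,y,z\}\cup L_1\cup R_1\cup R_2\cup L_2\cup W$, where $L_1,R_1,R_2,L_2$ are pairwise disjoint (and disjoint from $\{x,y,z\}$), the set $W$ may intersect $L_1\cup R_1\cup R_2\cup L_2$, and $N(x)=\{y,z\}$. (1) $\mathcal{F}_2^1$: $W=L_1=L_2=R_2=\emptyset$, $R_1\ne\emptyset$; $y$ and $z$ are both adjacent to every vertex of $R_1$, $yz$ is not an edge; arbitrary edges (possibly none) among vertices of $R_1$. The graph has $\delta=2$ and no full vertex. (2) $\mathcal{F}_2^2$: $W=L_2=R_2=\emptyset$, $L_1\ne\emptyset$, $R_1\ne\emptyset$; $y$ is adjacent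 to every vertex of $L_1\cup R_1$, $yz$ is not an edge; $z$ is adjacent to every vertex of $R_1$ and to no vertex of $L_1$; $G[L_1]$ is complete; arbitrary edges (possibly none) among vertices of $R_1$; finally any additional edges may be added while maintaining minimum degree $2$ and not creating a full vertex. The graph has $\delta=2$ and no full vertex. (3) $\mathcal{F}_2^3$: $L_1,R_2,W$ are nonempty and $L_2\subseteq W$ (possibly $L_2=\emptyset$); $G[W]$ is complete and every vertex of $W$ is adjacent to all vertices of $L_1\cup R_1\cup R_2$; $y$ is adjacent to every vertex of $L_1\cup R_1$ and to no vertex of $R_2$; $z$ is adjacent to every vertex of $R_1\cup R_2$ and to no vertex of $L_1$; each vertex of $R_1$ is adjacent to all vertices of $L_1$ or to all vertices of $R_2$. Either $yz$ is not an edge, in which case $G[L_1]$ and $G[R_2]$ are complete; or $yz$ is an edge, in which case each vertex of $L_1$ is adjacent to all (other) vertices of $L_1$ or to all vertices of $R_2$, and likewise each vertex of $R_2$ is adjacent to all vertices of $L_1$ or to all (other) vertices of $R_2$. Finally any additional edges may be added while maintaining minimum degree $2$ and not creating a full vertex. The graph has $\delta=2$ and no full vertex. The family $\mathcal{H}_2=\mathcal{H}_2^1\cup\mathcal{H}_2^2\cup\mathcal{H}_2^3$: (1) $\mathcal{H}_2^1$: vertex set $\{x',y',z'\}\cup R_1'$ with $R_1'\neq\emptyset$; $\{x',y',z'\}$ induces $K_3$; every vertex of $R_1'$ is adjacent to both $y'$ and $z'$; $R_1'$ is independent; additionally $x'$ may be joined to some (possibly none) vertices of $R_1'$; no other edges.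 (2) $\mathcal{H}_2^2$: vertex set $\{x',y',z'\}\cup R_1'\cup L_1'$ with $R_1'\ne\emptyset$, $L_1'\ne\emptyset$; $y'$ is adjacent to every vertex of $R_1'$ and to $x'$ and $z'$; $z'$ is adjacent to every vertex of $L_1'$; $x'z'$ is not an edge; no vertex of $L_1'$ is adjacent to $y'$; $L_1'\cup R_1'$ is independent; additional edges may be added (possibly none), subject to every vertex of $L_1'$ either having degree 1 with unique neighbor $z'$ or having degree 2 with neighbors $x'$ and $z'$. (3) $\mathcal{H}_2^3$: vertex set $\{x',y',z'\}\cup L_1'\cup R_1'\cup R_2'\cup W'$ with $W'\ne\emptyset$, the sets $L_1',R_1',R_2',W'$ pairwise disjoint and $L_1',R_1',R_2'$ possibly empty; $L_1'\cup R_1'\cup R_2'\cup W'$ is independent; $x'y'$ and $x'z'$ are not edges; $x'$ is adjacent to all vertices of $W'$ and to no vertex of $\{y',z'\}\cup L_1'\cup R_1'\cup R_2'$; each vertex of $L_1'\cup R_1'\cup R_2'$ is adjacent to at least one of $y'$ and $z'$. *)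

(* Defs.v *)
From mathcomp Require Import all_boot.

Set Implicit Arguments.
Unset Strict Implicit.
Unset Printing Implicit Defensive.

Record sgraph := SGraph {
  vertex :> finType;
  adj : rel vertex;
  adj_sym : symmetric adj;
  adj_irr : irreflexive adj }.

Notation "u -- v" := (adj u v) (at level 30, no associativity).

Definition nbhd (G : sgraph) (v : G) : {set G} := [set u | v -- u].

Definition degree (G : sgraph) (v : G) : nat := #|nbhd v|.

Definition has_min_degree (G : sgraph) (d : nat) : Prop :=
  (forall v : G, d <= degree v) /\ (exists v : G, degree v = d).

Definition full_vertex (G : sgraph) (v : G) : bool :=
  [forall u, (u != v) ==> v -- u].

Definition dominating (G : sgraph) (D : {set G}) : bool :=
  [forall v, (v \notin D) ==> [exists u in D, v -- u]].

Definition coalition (G : sgraph) (A B : {set G}) : bool :=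
  [&& [disjoint A & B], ~~ dominating A, ~~ dominating B
    & dominating (A :|: B)].

Lemma coalition_sym (G : sgraph) : symmetric (@coalition G).
Proof.
by move=> A B; rewrite /coalition disjoint_sym setUC; congr (_ && _); rewrite andbCA.
Qed.

Lemma coalition_irr (G : sgraph) : irreflexive (@coalition G).
Proof.
by move=> A; rewrite /coalition setUid; case: (dominating A); rewrite /= ?andbF.
Qed.

Definition coalition_partition (G : sgraph) (P : {set {set G}}) : bool :=
  partition P [set: G] &&
  [forall A in P,
    (dominating A && (#|A| == 1)) ||
    (~~ dominating A && [exists B in P, (B != A) && coalition A B])].

(* The vertex type is the type of members of P. *)
Definition coalition_graph (G : sgraph) (P : {set {set G}}) : sgraph :=
  @SGraph {A : {set G} | A \in P}
    (fun A B => coalition (val A) (val B))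
    (fun A B => coalition_sym (val A) (val B))
    (fun A => coalition_irr (val A)).

Definition Gamma1 (G : sgraph) : {set {set G}} := [set [set v] | v : G].

Definition singleton_partition_graph (G : sgraph) : bool :=
  coalition_partition (Gamma1 G).

(* The side condition u != v only matters when v belongs to S, in which case
   it excludes v itself. *)
Definition adj_all (G : sgraph) (v : G) (S : {set G}) : Prop :=
  forall u, u \in S -> u != v -> v -- u.

Definition adj_none (G : sgraph) (v : G) (S : {set G}) : Prop :=
  forall u, u \in S -> ~~ v -- u.

Definition clique (G : sgraph) (S : {set G}) : Prop :=
  forall u v, u \in S -> v \in S -> u != v -> u -- v.

Definition independent (G : sgraph) (S : {set G}) : Prop :=
  forall u v, u \in S -> v \in S -> ~~ u -- v.

Definition pairwise_disjoint (T : finType) (s : seq {set T}) : bool :=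
  pairwise (fun A B : {set T} => [disjoint A & B]) s.

(* Each family below is a property of a graph asserting that suitable vertices
   and vertex sets exist, so it is closed under isomorphism. Optional extra
   edges are rendered by leaving the remaining adjacencies unconstrained: the
   listed conditions hold in the final graph. *)

Record F2_setup (G : sgraph) (x y z : G) (L1 R1 R2 L2 W : {set G}) : Prop := {
  F2_xyz : uniq [:: x; y; z];
  F2_cover : [set: G] = [set x; y; z] :|: L1 :|: R1 :|: R2 :|: L2 :|: W;
  F2_disj : pairwise_disjoint [:: [set x; y; z]; L1; R1; R2; L2];
  F2_Nx : nbhd x = [set y; z];
  F2_delta : has_min_degree G 2;
  F2_nofull : forall v : G, ~~ full_vertex v }.

Definition in_F2_1 (G : sgraph) : Prop :=
  exists (x y z : G) (R1 : {set G}),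
  [/\ F2_setup x y z set0 R1 set0 set0 set0,
      R1 != set0,
      adj_all y R1,
      adj_all z R1 &
      ~~ y -- z].

Definition in_F2_2 (G : sgraph) : Prop :=
  exists (x y z : G) (L1 R1 : {set G}),
  [/\ F2_setup x y z L1 R1 set0 set0 set0,
      L1 != set0 /\ R1 != set0,
      adj_all y (L1 :|: R1) /\ ~~ y -- z,
      adj_all z R1 /\ adj_none z L1 &
      clique L1].

Record F2_3_edges (G : sgraph) (y z : G) (L1 R1 R2 W : {set G}) : Prop := {
  F2_3_W_clique : clique W;
  F2_3_W_all : forall w, w \in W -> adj_all w (L1 :|: R1 :|: R2);
  F2_3_y_all : adj_all y (L1 :|: R1);
  F2_3_y_none : adj_none y R2;
  F2_3_z_all : adj_all z (R1 :|: R2);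
  F2_3_z_none : adj_none z L1;
  F2_3_R1 : forall r, r \in R1 -> adj_all r L1 \/ adj_all r R2;
  F2_3_yz :
    [/\ ~~ y -- z, clique L1 & clique R2]
    \/ [/\ y -- z,
          forall l, l \in L1 -> adj_all l L1 \/ adj_all l R2 &
          forall r, r \in R2 -> adj_all r L1 \/ adj_all r R2] }.

Definition in_F2_3 (G : sgraph) : Prop :=
  exists (x y z : G) (L1 R1 R2 L2 W : {set G}),
  [/\ F2_setup x y z L1 R1 R2 L2 W,
      [/\ L1 != set0, R2 != set0 & W != set0],
      L2 \subset W &
      F2_3_edges y z L1 R1 R2 W].

Definition in_F2 (G : sgraph) : Prop := [\/ in_F2_1 G, in_F2_2 G | in_F2_3 G].

Record H2_setup (H : sgraph) (x y z : H) (L1 R1 R2 W : {set H}) : Prop := {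
  H2_xyz : uniq [:: x; y; z];
  H2_cover : [set: H] = [set x; y; z] :|: L1 :|: R1 :|: R2 :|: W;
  H2_disj : pairwise_disjoint [:: [set x; y; z]; L1; R1; R2; W] }.

(* The only pairs left unconstrained join x to R1. *)
Definition in_H2_1 (H : sgraph) : Prop :=
  exists (x y z : H) (R1 : {set H}),
  [/\ H2_setup x y z set0 R1 set0 set0,
      R1 != set0,
      clique [set x; y; z],
      adj_all y R1 /\ adj_all z R1 &
      independent R1].

Record H2_2_edges (H : sgraph) (x y z : H) (L1 R1 : {set H}) : Prop := {
  H2_2_y_all : adj_all y R1;
  H2_2_yx : y -- x;
  H2_2_yz : y -- z;
  H2_2_z_all : adj_all z L1;
  H2_2_xz : ~~ x -- z;
  H2_2_y_none : adj_none y L1;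
  H2_2_indep : independent (L1 :|: R1);
  H2_2_L1 : forall l, l \in L1 ->
    (degree l = 1 /\ nbhd l = [set z])
    \/ (degree l = 2 /\ nbhd l = [set x; z]) }.

Definition in_H2_2 (H : sgraph) : Prop :=
  exists (x y z : H) (L1 R1 : {set H}),
  [/\ H2_setup x y z L1 R1 set0 set0,
      R1 != set0,
      L1 != set0 &
      H2_2_edges x y z L1 R1].

Record H2_3_edges (H : sgraph) (x y z : H) (L1 R1 R2 W : {set H}) : Prop := {
  H2_3_indep : independent (L1 :|: R1 :|: R2 :|: W);
  H2_3_xy : ~~ x -- y;
  H2_3_xz : ~~ x -- z;
  H2_3_x_all : adj_all x W;
  H2_3_x_none : adj_none x ([set y; z] :|: L1 :|: R1 :|: R2);
  H2_3_yz : forall u, u \in L1 :|: R1 :|: R2 -> u -- y \/ u -- z }.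

Definition in_H2_3 (H : sgraph) : Prop :=
  exists (x y z : H) (L1 R1 R2 W : {set H}),
  [/\ H2_setup x y z L1 R1 R2 W,
      W != set0 &
      H2_3_edges x y z L1 R1 R2 W].

Definition in_H2 (H : sgraph) : Prop := [\/ in_H2_1 H, in_H2_2 H | in_H2_3 H].

(* Main.v *)
(* Without full vertices no singleton dominates, so {u} and {v} form a coalition
   iff the two vertices together dominate G. As N[x] = {x, y, z}, every coalition
   meets {x, y, z}, whence all other vertices are independent in CG(G, Gamma_1);
   the remaining adjacencies follow by checking which pairs dominate. The same
   x, y, z, L1, R1 serve in the first two cases. In the third, W' consists of all
   coalition partners of x, and L1', R1', R2' are what is left of L1, R1, R2. *)
Require Import Defs.
From mathcomp Require Import all_boot.

Set Implicit Arguments.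
Unset Strict Implicit.
Unset Printing Implicit Defensive.

(** * Transport of [in_H2] along graph isomorphisms, and to the coalition graph *)

Lemma imset_bij_setT (aT rT : finType) (f : aT -> rT) :
  bijective f -> f @: [set: aT] = [set: rT].
Proof.
by case=> g _ gK; apply/setP=> h; rewrite inE -[h]gK imset_f ?inE.
Qed.

Lemma pairwise_disjoint_imset (aT rT : finType) (f : aT -> rT)
    (s : seq {set aT}) :
  injective f ->
  pairwise_disjoint [seq f @: A | A : {set aT} <- s] = pairwise_disjoint s.
Proof.
move=> f_inj; rewrite /pairwise_disjoint pairwise_map.
by apply: eq_pairwise => A B /=; rewrite imset_disjoint //; apply: in2W.
Qed.

Section Isomorphism.

Variables (K H : sgraph) (f : K -> H).
Hypotheses (f_bij : bijective f) (f_adj : forall u v, f u -- f v = u -- v).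

Let f_inj : injective f := bij_inj f_bij.

Lemma adj_all_imset (v : K) (S : {set K}) :
  adj_all v S -> adj_all (f v) (f @: S).
Proof.
by move=> vS _ /imsetP[u uS ->] uv; rewrite f_adj vS //; apply: contraNneq uv => ->.
Qed.

Lemma adj_none_imset (v : K) (S : {set K}) :
  adj_none v S -> adj_none (f v) (f @: S).
Proof. by move=> vS _ /imsetP[u uS ->]; rewrite f_adj vS. Qed.

Lemma clique_imset (S : {set K}) : clique S -> clique (f @: S).
Proof.
move=> cS _ _ /imsetP[u uS ->] /imsetP[v vS ->] uv.
by rewrite f_adj cS //; apply: contraNneq uv => ->.
Qed.

Lemma independent_imset (S : {set K}) :
  independent S -> independent (f @: S).
Proof. by move=> iS _ _ /imsetP[u uS ->] /imsetP[v vS ->]; rewrite f_adj iS. Qed.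

(** Surjectivity of [f] excludes neighbours of [f v] outside the image. *)
Lemma nbhd_imset (v : K) : nbhd (f v) = f @: nbhd v.
Proof.
have [g _ gK] := f_bij; apply/setP=> h; rewrite -[h]gK mem_imset //.
by rewrite !inE f_adj.
Qed.

Lemma degree_imset (v : K) : degree (f v) = degree v.
Proof. by rewrite /degree nbhd_imset card_imset. Qed.

Lemma imset_set3 (x y z : K) : f @: [set x; y; z] = [set f x; f y; f z].
Proof. by rewrite !imsetU !imset_set1. Qed.

Lemma H2_setup_imset (x y z : K) (L1 R1 R2 W : {set K}) :
  H2_setup x y z L1 R1 R2 W ->
  H2_setup (f x) (f y) (f z) (f @: L1) (f @: R1) (f @: R2) (f @: W).
Proof.
case=> xyz cover disj; split.
- by rewrite -(map_inj_uniq f_inj) in xyz.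
- by rewrite -(imset_bij_setT f_bij) cover -imset_set3 -!imsetU.
- by rewrite -imset_set3 -(pairwise_disjoint_imset _ f_inj) in disj *.
Qed.

(** The images under [f] of the witnesses in [K] are witnesses in [H]. This allows the family to be
    checked on the vertices of [G] instead of on a subtype of sets. *)
Lemma in_H2_iso : in_H2 K -> in_H2 H.
Proof.
case=> [[x [y [z [R1 [S R1n cl [yR zR] ind]]]]]
       |[x [y [z [L1 [R1 [S R1n L1n [yR yx yz zL xz yL ind dL]]]]]]]
       |[x [y [z [L1 [R1 [R2 [W [S Wn [ind xy xz xW xN yz]]]]]]]]]].
- apply: Or31; exists (f x), (f y), (f z), (f @: R1); split.
  + by have := H2_setup_imset S; rewrite imset0.
  + by rewrite imset_eq0.
  + by rewrite -imset_set3; apply: clique_imset.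
  + by split; apply: adj_all_imset.
  + exact: independent_imset.
- apply: Or32; exists (f x), (f y), (f z), (f @: L1), (f @: R1); split.
  + by have := H2_setup_imset S; rewrite imset0.
  + by rewrite imset_eq0.
  + by rewrite imset_eq0.
  + split; rewrite ?f_adj -?imsetU //; try exact: adj_all_imset.
    * exact: adj_none_imset.
    * exact: independent_imset.
    * move=> _ /imsetP[l lL ->]; rewrite degree_imset nbhd_imset.
      case: (dL l lL) => -[-> ->]; [left|right];
        by rewrite ?imsetU !imset_set1.
- apply: Or33; exists (f x), (f y), (f z).
  exists (f @: L1), (f @: R1), (f @: R2), (f @: W); split.
  + exact: H2_setup_imset.
  + by rewrite imset_eq0.
  + split; rewrite ?f_adj -?imsetU //.
    * exact: independent_imset.
    * exact: adj_all_imset.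
    * by rewrite -!imset_set1 -!imsetU; apply: adj_none_imset.
    * by move=> _ /imsetP[u uS ->]; rewrite !f_adj; apply: yz.
Qed.

End Isomorphism.

(* CG(G, Gamma_1) transported to the vertices of G along v |-> {v}. *)
Definition vertex_coalition_graph (G : sgraph) : sgraph :=
  @SGraph G (fun u v => coalition [set u] [set v])
    (fun u v => coalition_sym [set u] [set v])
    (fun u => coalition_irr [set u]).

(** The map $v \mapsto \{v\}$ preserves adjacency by definition; it is injective between types of
    equal cardinality, hence bijective. *)
Lemma in_H2_coalition_graph (G : sgraph) :
  in_H2 (vertex_coalition_graph G) -> in_H2 (coalition_graph (Gamma1 G)).
Proof.
have set1_Gamma1 (v : G) : [set v] \in Gamma1 G by apply: imset_f.
pose f (v : vertex_coalition_graph G) : coalition_graph (Gamma1 G) :=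
  exist (fun A => A \in Gamma1 G) [set v : G] (set1_Gamma1 v).
apply: (@in_H2_iso _ _ f) => //; apply: inj_card_bij => [u v [] /set1_inj //|].
rewrite card_sig (eq_card (B := mem (Gamma1 G))) //.
by rewrite card_imset //; apply: set1_inj.
Qed.

(** * Coalitions of singletons when there is no full vertex *)

Section NoFullVertex.

Variable G : sgraph.
Hypothesis no_full : forall v : G, ~~ full_vertex v.

Lemma dominating_set1 (v : G) : dominating [set v] = false.
Proof.
apply: contraNF (no_full v) => /forallP dom_v; apply/forallP=> u.
apply/implyP=> uv; have := dom_v u; rewrite inE uv => /existsP[w].
by rewrite inE => /andP[/eqP->]; rewrite adj_sym.
Qed.

Lemma coalition_set1 (u v : G) :
  u != v -> (forall w, w != u -> w != v -> u -- w || v -- w) ->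
  coalition [set u] [set v].
Proof.
move=> uv dom; rewrite /coalition !dominating_set1 disjoints1 inE uv /=.
apply/forallP=> w; apply/implyP; rewrite !inE negb_or => /andP[wu wv].
by case/orP: (dom w wu wv) => a; apply/existsP;
  [exists u | exists v]; rewrite !inE eqxx ?orbT adj_sym.
Qed.

(** Serves to refute coalitions: it suffices to exhibit a third vertex [w] adjacent to neither [u]
    nor [v]. *)
Lemma coalition_set1_dom (u v : G) :
  coalition [set u] [set v] ->
  forall w, w != u -> w != v -> u -- w || v -- w.
Proof.
move=> co w; move: co; case/and4P=> _ _ _ /forallP/(_ w); rewrite !inE => dom wu wv.
move: dom; rewrite negb_or wu wv => /existsP[t]; rewrite !inE adj_sym.
by case/andP=> /orP[]/eqP-> ->; rewrite ?orbT.
Qed.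

(** No singleton dominates, so every member of $\Gamma_1$ needs a partner; disjointness in
    [coalition] makes that partner a different member. *)
Lemma singleton_partition_graphP :
  (forall u : G, exists v : G, coalition [set u] [set v]) ->
  singleton_partition_graph G.
Proof.
move=> co; apply/andP; split.
  apply/and3P; split.
  - by apply/eqP/setP=> v; rewrite inE; apply/bigcupP; exists [set v];
      rewrite ?inE // imset_f.
  - apply/trivIsetP=> _ _ /imsetP[u _ ->] /imsetP[v _ ->] uv.
    by rewrite disjoints1 inE; apply: contraNneq uv => ->.
  - by apply/imsetP=> -[v _ /setP/(_ v)]; rewrite !inE eqxx.
apply/forallP=> A; apply/implyP=> /imsetP[u _ ->].
have [v uv] := co u; rewrite dominating_set1 /=; apply/existsP; exists [set v].
rewrite imset_f //= uv andbT; case/and4P: uv => + _ _ _.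
by rewrite disjoints1 inE; apply: contraNneq => /set1_inj->.
Qed.

End NoFullVertex.

(** * Facts common to the three subfamilies of $\mathcal{F}_2$ *)

Section F2.

Variables (G : sgraph) (x y z : G) (L1 R1 R2 L2 W : {set G}).
Hypothesis S : F2_setup x y z L1 R1 R2 L2 W.

Lemma F2_adj_x u : x -- u = (u == y) || (u == z).
Proof. by have /setP/(_ u) := F2_Nx S; rewrite !inE. Qed.

Lemma F2_neq : [/\ x != y, x != z & y != z].
Proof. by have := F2_xyz S; rewrite /= !inE negb_or andbT => /andP[/andP[]]. Qed.

(** Case analysis on the cover of the vertex set, phrased as an eliminator for use with [elim/]. The
    cases may overlap, as [W] can meet the other sets. *)
Lemma F2_ind (P : G -> Prop) :
  P x -> P y -> P z -> {in L1, forall u, P u} -> {in R1, forall u, P u} ->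
  {in R2, forall u, P u} -> {in L2 :|: W, forall u, P u} -> forall u, P u.
Proof.
move=> Px Py Pz PL PR1 PR2 PW u; have : u \in [set: G] by [].
rewrite (F2_cover S) -setUA => /setUP[|/PW //].
move=> /setUP[|/PR2 //] /setUP[|/PR1 //] /setUP[|/PL //].
by rewrite !inE => /orP[/orP[]|] /eqP->.
Qed.

Lemma F2_disjoint_xyz :
  [/\ [disjoint [set x; y; z] & L1], [disjoint [set x; y; z] & R1],
      [disjoint [set x; y; z] & R2] & [disjoint [set x; y; z] & L2]].
Proof. by have := F2_disj S; rewrite /pairwise_disjoint /= => /andP[/and5P[]]. Qed.

(* A coalition must dominate x, whose closed neighbourhood is {x, y, z}. *)
Lemma F2_coalition_xyz (u v : G) :
  u \notin [set x; y; z] -> v \notin [set x; y; z] ->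
  ~~ coalition [set u] [set v].
Proof.
rewrite !inE !negb_or => /andP[/andP[ux uy] uz] /andP[/andP[vx vy] vz].
apply/negP=> /coalition_set1_dom/(_ x).
rewrite ![_ -- x]adj_sym !F2_adj_x (negPf uy) (negPf uz) (negPf vy) (negPf vz).
by rewrite ![x == _]eq_sym ux vx => /(_ isT isT).
Qed.

End F2.

(** * The subfamilies $\mathcal{F}_2^1$ and $\mathcal{F}_2^2$ *)

Lemma F2_H2_setup (G : sgraph) (x y z : G) (L1 R1 : {set G}) :
  F2_setup x y z L1 R1 set0 set0 set0 ->
  H2_setup (H := vertex_coalition_graph G) x y z L1 R1 set0 set0.
Proof. by case=> xyz cover disj _ _ _; split=> //; rewrite [LHS]cover !setU0. Qed.

(** Only [z] can escape [u], and [v] takes care of it by being [z] or a neighbour of [z]. *)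
Lemma coalition_set1_almost_full (G : sgraph) (u z v : G) :
  (forall w : G, ~~ full_vertex w) ->
  (forall w, w != u -> w != z -> u -- w) -> u != v -> (v == z) || v -- z ->
  coalition [set u] [set v].
Proof.
move=> nf uP uv vz; apply: coalition_set1 => // w wu wv.
have [wz|wz] := eqVneq w z; last by rewrite uP.
by move: vz wv; rewrite wz eq_sym => /orP[->|->]; rewrite ?orbT.
Qed.

(** Here [y] misses only [z] and [z] misses only [y], so each of the two forms a coalition with
    every other vertex. *)
Lemma in_F2_1_coalitions (G : sgraph) :
  in_F2_1 G ->
  singleton_partition_graph G /\ in_H2_1 (vertex_coalition_graph G).
Proof.
case=> x [y [z [R1 [S R1n yR zR yz]]]].
have nf := F2_nofull S; have [nxy nxz nyz] := F2_neq S; have ax := F2_adj_x S.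
have [xy xz] : x -- y /\ x -- z by rewrite !ax !eqxx orbT.
have [_ xyzR _ _] := F2_disjoint_xyz S.
have yP w : w != y -> w != z -> y -- w.
  by elim/(F2_ind S): w => [||| w | w wR wy _ | w | w];
    rewrite ?inE ?eqxx // ?[y -- x]adj_sym // yR.
have zP w : w != z -> w != y -> z -- w.
  by elim/(F2_ind S): w => [||| w | w wR wz _ | w | w];
    rewrite ?inE ?eqxx // ?[z -- x]adj_sym // zR.
have coy v : y != v -> coalition [set y] [set v].
  move=> yv; apply: (@coalition_set1_almost_full _ _ z) => //.
  by have [//|vz] := eqVneq v z; rewrite adj_sym zP // eq_sym.
have coz v : z != v -> coalition [set z] [set v].
  move=> zv; apply: (@coalition_set1_almost_full _ _ y) => //.
  by have [//|vy] := eqVneq v y; rewrite adj_sym yP // eq_sym.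
have coy' v : v != y -> coalition [set v] [set y].
  by rewrite coalition_sym eq_sym; apply: coy.
have coz' v : v != z -> coalition [set v] [set z].
  by rewrite coalition_sym eq_sym; apply: coz.
split.
  apply: singleton_partition_graphP => // u.
  have [->|uy] := eqVneq u y; first by exists z; apply: coy.
  by exists y; apply: coy'.
exists x, y, z, R1; split=> //.
- exact: F2_H2_setup.
- move=> u v; rewrite !inE => /orP[/orP[]|] /eqP-> /orP[/orP[]|] /eqP-> uv /=;
    by [rewrite eqxx in uv | apply: coy | apply: coz | apply: coy' | apply: coz'].
- by split=> u _ uv /=; [apply: coy | apply: coz]; rewrite eq_sym.
- move=> u v uR vR; apply: (F2_coalition_xyz S).
    by rewrite (disjointFl xyzR).
  by rewrite (disjointFl xyzR).
Qed.

Lemma in_F2_2_coalitions (G : sgraph) :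
  in_F2_2 G ->
  singleton_partition_graph G /\ in_H2_2 (vertex_coalition_graph G).
Proof.
case=> x [y [z [L1 [R1 [S [L1n R1n] [yLR yz] [zR zL] cL]]]]].
have nf := F2_nofull S; have [nxy nxz nyz] := F2_neq S; have ax := F2_adj_x S.
have [xy xz] : x -- y /\ x -- z by rewrite !ax !eqxx orbT.
have [xyzL xyzR _ _] := F2_disjoint_xyz S.
have yP w : w != y -> w != z -> y -- w.
  by elim/(F2_ind S): w => [||| w wL wy _ | w wR wy _ | w | w];
    rewrite ?inE ?eqxx // ?[y -- x]adj_sym // yLR // inE ?wL ?wR ?orbT.
have coy v : y != v -> (v == z) || v -- z -> coalition [set y] [set v].
  exact: coalition_set1_almost_full.
(* [z] reaches [x] and [R1], while [l] reaches [y] and, [L1] being a clique, the rest of [L1]. *)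
have cozL l : l \in L1 -> coalition [set z] [set l].
  move=> lL; have := disjointFl xyzL lL; rewrite !inE => /norP[/norP[lx ly] lz].
  apply: coalition_set1 => //; first by rewrite eq_sym.
  move=> w; elim/(F2_ind S): w => [||| w wL _ wl | w wR wz _ | w | w];
    rewrite ?inE ?eqxx // ?[z -- x]adj_sym ?xz //.
  - by rewrite [l -- y]adj_sym yP ?orbT.
  - by rewrite [l -- w]cL ?orbT // eq_sym.
  - by rewrite zR.
have coyz : coalition [set y] [set z] by rewrite coy ?eqxx.
have coyx : coalition [set y] [set x] by rewrite coy ?xz ?orbT // eq_sym.
have coyR r : r \in R1 -> coalition [set y] [set r].
  move=> rR; have := disjointFl xyzR rR; rewrite !inE => /norP[/norP[rx ry] rz].
  by rewrite coy ?[r -- z]adj_sym ?zR ?orbT // eq_sym.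
(* Neither [y] nor [l] dominates [z]. *)
have coyL l : l \in L1 -> ~~ coalition [set y] [set l].
  move=> lL; have := disjointFl xyzL lL; rewrite !inE => /norP[/norP[lx ly] lz].
  apply/negP=> /coalition_set1_dom/(_ z); rewrite (negPf yz) [l -- z]adj_sym.
  by rewrite (negPf (zL l lL)) ![z == _]eq_sym nyz lz => /(_ isT isT).
(* Any vertex of [L1] is missed by both [x] and [z]. *)
have coxz : ~~ coalition [set x] [set z].
  have [l lL] := set0Pn _ L1n.
  have := disjointFl xyzL lL; rewrite !inE => /norP[/norP[lx ly] lz].
  apply/negP=> /coalition_set1_dom/(_ l lx lz).
  by rewrite ax (negPf ly) (negPf lz) (negPf (zL l lL)).
have ind u v : u \in L1 :|: R1 -> v \in L1 :|: R1 -> ~~ coalition [set u] [set v].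
  have nxyz w : w \in L1 :|: R1 -> w \notin [set x; y; z].
    by case/setUP=> wA; rewrite ?(disjointFl xyzL wA) ?(disjointFl xyzR wA).
  by move=> uA vA; apply: (F2_coalition_xyz S); apply: nxyz.
(* The partners of [l] are [z] and possibly [x]. Whether [l] and [x] form a coalition decides
   between the two alternatives of [H2_2_L1]. *)
have NL (l u : G) : l \in L1 ->
    coalition [set l] [set u] = (u == z) || (u == x) && coalition [set l] [set x].
  move=> lL; have := disjointFl xyzL lL; rewrite !inE => /norP[/norP[lx ly] lz].
  elim/(F2_ind S): u => [||| u uL | u uR | u | u]; rewrite ?inE //.
  - by rewrite eqxx (negPf nxz).
  - by rewrite coalition_sym (negPf (coyL l lL)) (negPf nyz) eq_sym (negPf nxy).
  - by rewrite coalition_sym cozL // eqxx.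
  - have := disjointFl xyzL uL; rewrite !inE => /norP[/norP[ux _] uz].
    by rewrite (negPf (ind l u _ _)) ?inE ?lL ?uL // (negPf ux) (negPf uz).
  - have := disjointFl xyzR uR; rewrite !inE => /norP[/norP[ux _] uz].
    by rewrite (negPf (ind l u _ _)) ?inE ?lL ?uR ?orbT // (negPf ux) (negPf uz).
split.
  apply: singleton_partition_graphP => // u.
  elim/(F2_ind S): u => [||| u uL | u uR | u | u]; rewrite ?inE //.
  - by exists y; rewrite coalition_sym.
  - by exists z.
  - by exists y; rewrite coalition_sym.
  - by exists z; rewrite coalition_sym cozL.
  - by exists y; rewrite coalition_sym coyR.
exists x, y, z, L1, R1; split=> //.
  exact: F2_H2_setup.
split=> //.
- by move=> r rR _ /=; rewrite coyR.
- by move=> l lL _ /=; rewrite cozL.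
move=> l lL; rewrite /degree.
have -> : nbhd l = [set u : G | (u == z) || (u == x) && coalition [set l : G] [set x]].
  by apply/setP=> u; rewrite !inE -NL.
case: (coalition _ _); [right|left].
  have -> : [set u | (u == z) || (u == x) && true] = [set x; z].
    by apply/setP=> u; rewrite !inE andbT orbC.
  by rewrite cards2 nxz.
have -> : [set u | (u == z) || (u == x) && false] = [set z].
  by apply/setP=> u; rewrite !inE andbF orbF.
by rewrite cards1.
Qed.

(** * The subfamily $\mathcal{F}_2^3$ *)

Lemma in_F2_3_coalitions (G : sgraph) :
  in_F2_3 G ->
  singleton_partition_graph G /\ in_H2_3 (vertex_coalition_graph G).
Proof.
case=> x [y [z [L1 [R1 [R2 [L2 [W [S [L1n R2n Wn] L2W E]]]]]]]].
have nf := F2_nofull S; have [nxy nxz nyz] := F2_neq S; have ax := F2_adj_x S.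
have [xy xz] : x -- y /\ x -- z by rewrite !ax !eqxx orbT.
have [xyzL xyzR1 xyzR2 _] := F2_disjoint_xyz S.
case: E => W_cl W_all yLR yR2 zRR zL1 R1P yzP.
(* [l0] is missed by [x] and [z], and [r0] by [x] and [y]; they later refute the coalitions of [x]
   with [z] and with [y]. *)
have [l0 l0L] := set0Pn _ L1n; have [r0 r0R] := set0Pn _ R2n.
have [w0 w0W] := set0Pn _ Wn.
pose A := L1 :|: R1 :|: R2.
have A_xyz u : u \in A -> u \notin [set x; y; z].
  by case/setUP=> [/setUP[]|] uA;
    rewrite ?(disjointFl xyzL uA) ?(disjointFl xyzR1 uA) ?(disjointFl xyzR2 uA).
have A_neq u : u \in A -> [/\ u != x, u != y & u != z].
  by move/A_xyz; rewrite !inE => /norP[/norP[]].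
have l0A : l0 \in A by rewrite !inE l0L.
have r0A : r0 \in A by rewrite !inE r0R orbT.
have xA u : u \in A -> ~~ x -- u.
  by case/A_neq=> ux uy uz; rewrite ax negb_or uy.
(* Each of x, y, z has a non-neighbour in L1 or R2, so W avoids them. *)
have W_xyz w : w \in W -> w \notin [set x; y; z].
  move=> wW; have al := W_all w wW l0 l0A; have ar := W_all w wW r0 r0A.
  have [lx ly lz] := A_neq _ l0A; have [rx ry rz] := A_neq _ r0A.
  rewrite !inE !negb_or; apply/andP; split; first (apply/andP; split).
  - by apply: contraTneq lx => wx;
      move: al; rewrite wx (negPf (xA _ l0A)); case: eqP => // _ /(_ isT).
  - by apply: contraTneq ry => wy;
      move: ar; rewrite wy (negPf (yR2 _ r0R)); case: eqP => // _ /(_ isT).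
  - by apply: contraTneq lz => wz;
      move: al; rewrite wz (negPf (zL1 _ l0L)); case: eqP => // _ /(_ isT).
have W_neq w : w \in W -> [/\ w != x, w != y & w != z].
  by move/W_xyz; rewrite !inE => /norP[/norP[]].
have ind3 (P : G -> Prop) : P x -> P y -> P z -> {in L1, forall u, P u} ->
  {in R1, forall u, P u} -> {in R2, forall u, P u} -> {in W, forall u, P u} ->
  forall u, P u.
  move=> Px Py Pz PL PR1 PR2 PW; apply: (F2_ind S) => // u.
  by move/setUP=> [/(subsetP L2W)|]; apply: PW.
(* [x] reaches [y] and [z], and [w] reaches everything else. *)
have coxW w : w \in W -> coalition [set x] [set w].
  move=> wW; have [wx wy wz] := W_neq w wW.
  apply: coalition_set1 => //; first by rewrite eq_sym.
  move=> u; elim/ind3: u => [||| u uA | u uA | u uA | u uW] ux uw;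
    rewrite ?xy ?xz // ?eqxx // in ux *.
  - by rewrite [w -- u]W_all ?orbT // !inE uA.
  - by rewrite [w -- u]W_all ?orbT // !inE uA ?orbT.
  - by rewrite [w -- u]W_all ?orbT // !inE uA ?orbT.
  - by rewrite [w -- u]W_cl ?orbT // eq_sym.
(* [y] reaches [x], [L1] and [R1], and [u] reaches [W]. What remains is [z] and [R2], which the last
   two hypotheses handle; [cozA] is the mirror image. *)
have coyA u : u \in A -> u -- z || y -- z -> adj_all u R2 -> coalition [set y] [set u].
  move=> uA uz uR2; have [nux nuy nuz] := A_neq u uA.
  apply: coalition_set1 => //; first by rewrite eq_sym.
  move=> v; elim/ind3: v => [||| v vA | v vA | v vA | v vW] vy vu;
    rewrite ?eqxx // in vy *.
  - by rewrite [y -- x]adj_sym xy.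
  - by rewrite orbC.
  - by rewrite yLR ?inE ?vA.
  - by rewrite yLR ?inE ?vA ?orbT.
  - by rewrite [u -- v]uR2 ?orbT.
  - by rewrite [u -- v]adj_sym [v -- u]W_all ?orbT // eq_sym.
have cozA u : u \in A -> u -- y || y -- z -> adj_all u L1 -> coalition [set z] [set u].
  move=> uA uy uL1; have [nux nuy nuz] := A_neq u uA.
  apply: coalition_set1 => //; first by rewrite eq_sym.
  move=> v; elim/ind3: v => [||| v vA | v vA | v vA | v vW] vz vu;
    rewrite ?eqxx // in vz *.
  - by rewrite [z -- x]adj_sym xz.
  - by rewrite orbC [z -- y]adj_sym.
  - by rewrite [u -- v]uL1 ?orbT.
  - by rewrite zRR ?inE ?vA.
  - by rewrite zRR ?inE ?vA ?orbT.
  - by rewrite [u -- v]adj_sym [v -- u]W_all ?orbT // eq_sym.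
(* If [yz] is not an edge, the cliques pair [L1] with [z] and [R2] with [y]. Otherwise, and always
   for [R1], the choice depends on which of [L1], [R2] the vertex [u] sees entirely. *)
have coA u : u \in A -> coalition [set y] [set u] \/ coalition [set z] [set u].
  move=> uA; have [_ uy uz] := A_neq u uA; have := uA.
  case/setUP=> [/setUP[]|] uB.
  - have u_y : u -- y by rewrite adj_sym yLR ?inE ?uB.
    case: yzP => [[_ cL _]|[yz lP _]].
      by right; apply: cozA; rewrite ?u_y // => v vL vu; rewrite cL // eq_sym.
    by case: (lP u uB) => uP; [right; apply: cozA|left; apply: coyA];
      rewrite ?yz ?orbT.
  - have u_y : u -- y by rewrite adj_sym yLR ?inE ?uB ?orbT.
    have u_z : u -- z by rewrite adj_sym zRR ?inE ?uB.
    by case: (R1P u uB) => uP; [right; apply: cozA|left; apply: coyA];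
      rewrite ?u_y ?u_z.
  - have u_z : u -- z by rewrite adj_sym zRR ?inE ?uB ?orbT.
    case: yzP => [[_ _ cR]|[yz _ rP]].
      by left; apply: coyA; rewrite ?u_z // => v vR vu; rewrite cR // eq_sym.
    by case: (rP u uB) => uP; [right; apply: cozA|left; apply: coyA];
      rewrite ?yz ?orbT.
(* Treats [y] and [z] together: by irreflexivity, [u -- v] forces [u] and [v] to be the two ends of
   the edge [yz]. Then [u] reaches [x] and [v], and [w0] the rest. *)
have co_w0 u v : u \in [set y; z] -> v \in [set y; z] -> u -- v ->
    coalition [set u] [set w0].
  move=> uyz vyz uv; have [wx wy wz] := W_neq w0 w0W.
  apply: coalition_set1 => //; first by case/set2P: uyz => ->; rewrite eq_sym.
  have yzu t : t \in [set y; z] -> t != u -> u -- t.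
    move: uyz vyz uv; rewrite !inE.
    by move=> /orP[]/eqP-> /orP[]/eqP-> uv /orP[]/eqP-> tu;
      rewrite ?adj_irr ?eqxx // in uv tu *.
  move=> t; elim/ind3: t => [||| t tA | t tA | t tA | t tW] tu tw.
  - by rewrite adj_sym ax -in_set2 uyz.
  - by rewrite yzu ?inE ?eqxx.
  - by rewrite yzu ?inE ?eqxx ?orbT.
  - by rewrite [w0 -- t]W_all ?orbT // !inE tA.
  - by rewrite [w0 -- t]W_all ?orbT // !inE tA ?orbT.
  - by rewrite [w0 -- t]W_all ?orbT // !inE tA ?orbT.
  - by rewrite [w0 -- t]W_cl ?orbT // eq_sym.
have [yI zI] : y \in [set y; z] /\ z \in [set y; z] by rewrite !inE !eqxx orbT.
(* The partner of [y] is [r0] if [yz] is not an edge and [w0] if it is; for [z], [l0] replaces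
   [r0]. *)
have coy : exists v, coalition [set y] [set v].
  case: yzP => [[_ _ cR]|[yz _ _]]; last by exists w0; apply: (co_w0 _ z).
  exists r0; have [_ _ rz] := A_neq _ r0A; apply: coyA => //.
    by rewrite [r0 -- z]adj_sym zRR // inE r0R orbT.
  by move=> v vR vr; rewrite cR // eq_sym.
have coz : exists v, coalition [set z] [set v].
  case: yzP => [[_ cL _]|[yz _ _]]; last first.
    by exists w0; apply: (co_w0 _ y); rewrite // adj_sym.
  exists l0; have [_ ly _] := A_neq _ l0A; apply: cozA => //.
    by rewrite [l0 -- y]adj_sym yLR // inE l0L.
  by move=> v vL vl; rewrite cL // eq_sym.
split.
  apply: singleton_partition_graphP => // u.
  have coA' v : v \in A -> exists t, coalition [set v] [set t].
    by case/coA; rewrite coalition_sym; [exists y | exists z].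
  elim/ind3: u => // [|u uB|u uB|u uB|u uW].
  - by exists w0; apply: coxW.
  - by apply: coA'; rewrite !inE uB.
  - by apply: coA'; rewrite !inE uB orbT.
  - by apply: coA'; rewrite !inE uB orbT.
  - by exists x; rewrite coalition_sym coxW.
have coxy : ~~ coalition [set x] [set y].
  have [rx ry rz] := A_neq _ r0A.
  apply/negP=> /coalition_set1_dom/(_ r0 rx ry).
  by rewrite (negPf (xA _ r0A)) (negPf (yR2 _ r0R)).
have coxz : ~~ coalition [set x] [set z].
  have [lx ly lz] := A_neq _ l0A.
  apply/negP=> /coalition_set1_dom/(_ l0 lx lz).
  by rewrite (negPf (xA _ l0A)) (negPf (zL1 _ l0L)).
(* Vertices of L1, R1, R2 that also form a coalition with x must move to W'. *)
pose W' : {set G} := [set w | coalition [set x] [set w]].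
have W'_xyz w : w \in W' -> w \notin [set x; y; z].
  rewrite inE => xw; apply/negP; rewrite !inE => /orP[/orP[]|] /eqP wE; move: xw.
  - by rewrite wE coalition_irr.
  - by rewrite wE (negPf coxy).
  - by rewrite wE (negPf coxz).
have xyzW' : [disjoint [set x; y; z] & W'].
  rewrite disjoint_sym disjoints_subset.
  by apply/subsetP=> u /W'_xyz; rewrite [in X in _ -> X]inE.
have xyzD (B : {set G}) : [disjoint [set x; y; z] & B] ->
    [disjoint [set x; y; z] & B :\: W'].
  by move=> dB; apply: disjointWr dB; apply: subsetDl.
have DD (B C : {set G}) : [disjoint B & C] -> [disjoint B :\: W' & C :\: W'].
  by move=> dBC; apply: disjointW dBC; apply: subsetDl.
have DW (B : {set G}) : [disjoint B :\: W' & W'].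
  by rewrite -setI_eq0 setDE -setIA [~: _ :&: _]setIC setICr setI0.
have AW' : A :\: W' = (L1 :\: W') :|: (R1 :\: W') :|: (R2 :\: W').
  by rewrite !setDUl.
have cover u : u \in [set x; y; z] :|: (A :\: W') :|: W'.
  case: (boolP (u \in W')) => uW'; first by rewrite inE uW' orbT.
  apply/setUP; left; elim/ind3: u uW' => [||| u uB | u uB | u uB | u uB] uW';
    try by rewrite !inE !eqxx ?orbT.
  - by apply/setUP; right; apply/setDP; split=> //; rewrite !inE uB.
  - by apply/setUP; right; apply/setDP; split=> //; rewrite !inE uB orbT.
  - by apply/setUP; right; apply/setDP; split=> //; rewrite !inE uB orbT.
  (* [W] lies inside [W'], so a vertex outside [W'] cannot come from [W]. *)
  - by rewrite inE coxW in uW'.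
have AW'_xyz u : u \in (A :\: W') :|: W' -> u \notin [set x; y; z].
  by case/setUP=> [/setDP[/A_xyz]|/W'_xyz].
have ind u v : u \in (A :\: W') :|: W' -> v \in (A :\: W') :|: W' ->
    ~~ coalition [set u] [set v].
  by move=> /AW'_xyz uA /AW'_xyz vA; apply: (F2_coalition_xyz S).
have x_none u : u \in [set y; z] :|: (A :\: W') -> ~~ coalition [set x] [set u].
  by case/setUP=> [/set2P[]->|/setDP[_]]; rewrite ?inE.
have AW'_yz u : u \in A :\: W' ->
    coalition [set u] [set y] \/ coalition [set u] [set z].
  by rewrite ![coalition [set u] _]coalition_sym => /setDP[/coA].
exists x, y, z, (L1 :\: W'), (R1 :\: W'), (R2 :\: W'), W'; split.
- split; first exact: F2_xyz S.
  + apply/setP=> u; have := cover u; rewrite AW' !setUA => ->.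
    by rewrite inE.
  + have := F2_disj S; rewrite /pairwise_disjoint /= !andbT.
    case/and4P=> [/and4P[? ? ? _] /and3P[? ? _] /andP[? _] _].
    by rewrite !DW !DD ?xyzD // xyzW'.
- by apply/set0Pn; exists w0; rewrite inE coxW.
- split.
  + by move=> u v; rewrite -AW'; apply: ind.
  + exact: coxy.
  + exact: coxz.
  + by move=> w; rewrite inE.
  + by move=> u uA; apply: x_none; rewrite AW' !setUA.
  + by move=> u; rewrite -AW'; apply: AW'_yz.
Qed.

Theorem theorem7 (G : sgraph) :
  in_F2 G ->
  singleton_partition_graph G /\ in_H2 (coalition_graph (Gamma1 G)).
Proof.
case=> [/in_F2_1_coalitions|/in_F2_2_coalitions|/in_F2_3_coalitions] [? ?];
  split=> //; apply: in_H2_coalition_graph; by [apply: Or31|apply: Or32|apply: Or33].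
Qed.
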